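(* Let $m\ge 2$ be a fixed integer. For each $n$, let $A=\{a_{ij}\}$ and $B=\{b_{ij}\}$ be $n\times n$ matrices over $\mathbb{Z}_m$ whose entries are regarded as $2n^2$ distinct variables. (i) Suppose that $m$ has two distinct prime divisors. Then a 1-a-strong representation modulo $m$ of the product matrix $AB$ can be computed using $$n^2\, 2^{O(\sqrt{\log n\,\log\log n})}=n^{2+o(1)}$$ multiplications. (ii) Suppose that $m$ has $r$ distinct prime divisors, where $r\ge 2$. Then a 1-a-strong representation modulo $m$ of $AB$ can be computed using $$n^2\, 2^{O\left(\sqrt[r]{\log n\,(\log\log n)^{r-1}}\right)}=n^{2+o(1)}$$ multiplications. (iii) Moreover, the representations of (i) and (ii) can be computed on bilinear $\Sigma\Pi\Sigma$ circuits of size $n^2\, 2^{O(\sqrt{\log n\,\log\log n})}$ and $n^2\, 2^{O\left(\sqrt[r]{\log n\,(\log\log n)^{r-1}}\right)}$, respectively. Here the asymptotics are as $n\to\infty$, and the implied constants may depend on $m$ but not on $n$.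
   Context: $\mathbb{Z}_m$ denotes the ring of integers modulo $m$. Representations of polynomials. Let $m=p_1^{e_1}p_2^{e_2}\cdots p_\ell^{e_\ell}$ be the prime factorization of $m$, with distinct primes $p_j$. Let $f=\sum_{I\subset\{1,\dots,N\}}a_Ix_I$ and $g=\sum_{I\subset\{1,\dots,N\}}b_Ix_I$ be (formal, multilinear) polynomials in $N$ variables over $\mathbb{Z}_m$, where $x_I=\prod_{i\in I}x_i$. Then $g$ is an alternative representation of $f$ modulo $m$ if for every $I$ there is $j\in\{1,\dots,\ell\}$ with $a_I\equiv b_I\pmod{p_j^{e_j}}$. It is a 1-a-strong representation of $f$ modulo $m$ if it is an alternative representation and, furthermore, whenever $a_I\not\equiv b_I\pmod{p_i^{e_i}}$ for some $i$, then $a_I\equiv 0\pmod m$. Representations of matrix products. For $n\times n$ matrices $A=\{a_{ij}\}$ and $B=\{b_{ij}\}$ (entries treated as variables), a matrix $C=\{c_{ij}\}$ of polynomials over $\mathbb{Z}_m$ in these variables is a 1-a-strong representation modulo $m$ of $AB$ if, for all $1\le i,j\le n$, $c_{ij}$ is a 1-a-strong representation modulo $m$ of the polynomial $\sum_{k=1}^n a_{ik}b_{kj}$. Computation model. Computations are arithmetic over $\mathbb{Z}_m$ on formal polynomials, using additions, multiplications by constants from $\mathbb{Z}_m$, and multiplications of two computed polynomials; the number of multiplications counts only the last kind. A bilinear $\Sigma\Pi\Sigma$ circuit over $\mathbb{Z}_m$, with respect to two sets of variables $x$ and $y$ (here the entries of $A$ and the entries of $B$), is a depth-3 arithmetic circuit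 each of whose outputs is computed in the form $\sum_{t=1}^{L}L_t(x)\,M_t(y)$, where each $L_t$ is a homogeneous linear form in the $x$ variables and each $M_t$ is a homogeneous linear form in the $y$ variables, with coefficients in $\mathbb{Z}_m$. The size of the circuit is its number of gates (summation gates may have arbitrary fan-in and arbitrary coefficients from $\mathbb{Z}_m$). *)

(* Defs.v *)
From mathcomp Require Import all_boot all_order all_algebra.
(* The notations of [mpoly] clash with those of the analysis library. *)
From mathcomp Require Import -(notations) mpoly.
From mathcomp Require Import classical_sets reals topology normedtype landau.
From mathcomp Require Import exp sequences.

Set Implicit Arguments.
Unset Strict Implicit.
Unset Printing Implicit Defensive.

Import Order.TTheory GRing.Theory Num.Theory numFieldNormedType.Exports.

Local Open Scope ring_scope.
Local Open Scope classical_set_scope.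

(** Representations of polynomials. Throughout, the modulus satisfies [1 < m],
    so that ['Z_m] is the ring of integers modulo [m] and its elements coerce to
    their residues in [nat]; the prime powers exactly dividing [m] are the
    [p ^ logn p m] for [p] in [primes m]. *)

Definition multilinear (R : nzRingType) (N : nat) (f : mpoly N R) :=
  forall mon, mon \in msupp f -> forall i : 'I_N, (mon i <= 1)%N.

(* The coefficient of [x_I = \prod_(i in I) x_i]. *)
Definition set_coef (R : nzRingType) (N : nat) (f : mpoly N R)
    (I : {set 'I_N}) : R :=
  mcoeff (mesym1 I) f.

Definition alternative_representation (m N : nat) (f g : mpoly N 'Z_m) :=
  [/\ multilinear f, multilinear g
    & forall I : {set 'I_N}, exists2 p : nat, p \in primes m
      & (set_coef f I = set_coef g I %[mod p ^ logn p m])%N].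

Definition strong_1a_representation (m N : nat) (f g : mpoly N 'Z_m) :=
  alternative_representation f g /\
  forall (I : {set 'I_N}) (p : nat), p \in primes m ->
    (set_coef f I <> set_coef g I %[mod p ^ logn p m])%N ->
    set_coef f I = 0.

(** The entries of two [n * n] matrices as [n * n + n * n] distinct variables. *)

Notation matpoly m n := (mpoly (n * n + n * n) 'Z_m).

Definition Avar (m n : nat) (i j : 'I_n) : matpoly m n :=
  mpolyX _ (mnm1 (lshift (n * n) (mxvec_index i j))).

Definition Bvar (m n : nat) (i j : 'I_n) : matpoly m n :=
  mpolyX _ (mnm1 (rshift (n * n) (mxvec_index i j))).

Definition Amat (m n : nat) : 'M[matpoly m n]_n := \matrix_(i, j) Avar m i j.
Definition Bmat (m n : nat) : 'M[matpoly m n]_n := \matrix_(i, j) Bvar m i j.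

Definition strong_1a_product (m n : nat) (C : 'M[matpoly m n]_n) :=
  forall i j, strong_1a_representation ((Amat m n *m Bmat m n) i j) (C i j).

(** [computation s k]: the polynomials in [s] are the successive results (latest
    first) of a straight-line computation from the variables performing [k]
    multiplications of two computed polynomials. *)
Inductive computation (R : nzRingType) (N : nat) :
    seq (mpoly N R) -> nat -> Prop :=
| comp_nil : computation [::] 0
| comp_var s k (i : 'I_N) :
    computation s k -> computation (mpolyX R (mnm1 i) :: s) k
| comp_add s k f g :
    computation s k -> f \in s -> g \in s -> computation (f + g :: s) k
| comp_scale s k (c : R) f :
    computation s k -> f \in s -> computation (c *: f :: s) k
| comp_mul s k f g :
    computation s k -> f \in s -> g \in s -> computation (f * g :: s) k.+1.

Definition computable_with (m n : nat) (C : 'M[matpoly m n]_n) (k : nat) :=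
  exists2 s, computation s k & forall i j, C i j \in s.

(** Bilinear depth-3 circuits with inputs [X] and [Y] and outputs [Z]: a layer of
    summation gates computing homogeneous linear forms in the [X] inputs and in
    the [Y] inputs, a layer of multiplication gates, each multiplying one form of
    either kind (forms may be shared), and one summation gate per output. *)
Record bilinear_circuit (R : Type) (X Y Z : finType) := BilinearCircuit {
  xsums : nat;
  ysums : nat;
  prods : nat;
  xcoef : 'I_xsums -> X -> R;
  ycoef : 'I_ysums -> Y -> R;
  xarg : 'I_prods -> 'I_xsums;
  yarg : 'I_prods -> 'I_ysums;
  outcoef : Z -> 'I_prods -> R }.
Arguments xcoef {R X Y Z} _ _ _.
Arguments ycoef {R X Y Z} _ _ _.
Arguments xarg {R X Y Z} _ _.
Arguments yarg {R X Y Z} _ _.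
Arguments outcoef {R X Y Z} _ _ _.

Definition circuit_size (R : Type) (X Y Z : finType)
    (D : bilinear_circuit R X Y Z) : nat :=
  (xsums D + ysums D + prods D + #|Z|)%N.

Definition circuit_output (R : nzRingType) (P : lalgType R) (X Y Z : finType)
    (D : bilinear_circuit R X Y Z) (x : X -> P) (y : Y -> P) (z : Z) : P :=
  \sum_t outcoef D z t *:
    ((\sum_i xcoef D (xarg D t) i *: x i) *
     (\sum_j ycoef D (yarg D t) j *: y j)).

Notation matrix_circuit m n :=
  (bilinear_circuit 'Z_m ('I_n * 'I_n)%type ('I_n * 'I_n)%type
                         ('I_n * 'I_n)%type).

Definition circuit_computes (m n : nat) (D : matrix_circuit m n)
    (C : 'M[matpoly m n]_n) :=
  forall i j,
    C i j = circuit_output D (fun u => Avar m u.1 u.2)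
                             (fun u => Bvar m u.1 u.2) (i, j).

(** Classes of growth functions, for [n] tending to infinity. *)

(* n^2 2^O(g(n)) *)
Definition sq_exp_bigO (R : realType) (g : nat -> R) : set (nat -> R) :=
  [set b | exists2 h : nat -> R, h =O_\oo g
     & \forall n \near \oo, b n = n%:R ^+ 2 * 2 `^ h n].

(* n^(2 + o(1)) *)
Definition sq_littleo (R : realType) : set (nat -> R) :=
  [set b | exists2 e : nat -> R, e @ \oo --> (0 : R)
     & \forall n \near \oo, b n = n%:R `^ (2 + e n)].

Definition bounded_in (R : realType) (T : nat -> nat) (S : set (nat -> R)) :=
  exists2 b, S b & \forall n \near \oo, (T n)%:R <= b n.

(* The r-th root of log n (log log n)^(r - 1). *)
Definition root_growth (R : realType) (r n : nat) : R :=
  (ln n%:R * ln (ln n%:R) ^+ r.-1) `^ r%:R^-1.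

(* Main.v *)
Require Import Defs.
From mathcomp Require Import all_boot all_order all_algebra.
From mathcomp Require Import -(notations) mpoly.
From mathcomp Require Import classical_sets reals topology normedtype landau.
From mathcomp Require Import exp sequences.
From mathcomp Require Import cyclic boolp ring lra.

Set Implicit Arguments.
Unset Strict Implicit.
Unset Printing Implicit Defensive.

Import Order.TTheory GRing.Theory Num.Theory numFieldNormedType.Exports.

Local Open Scope ring_scope.

(** If [c = U V] with inner dimension [L], then [A c B = (A U) (V B)] is computed
    with [n^2 L] products, and its entries are the [\sum_k \sum_l c_kl a_ik b_lj].
    They 1-a-strongly represent those of [A B] as soon as [c_kk = 1] and every
    off-diagonal [c_kl] vanishes modulo some [p^e] exactly dividing [m].
    To get such a [c] with [L] small, choose powers [p^k >= H] of the primes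
    dividing [m], of product [N + 1], and attach to the indices distinct
    [N]-subsets [S_k] of a set of [N H] points; as ['C(N H, N) >= H^N],
    [H = (ln n / ln ln n)^(1/r)] suffices up to a constant factor. With
    [E = #|S_k :&: S_l|], ['C(E, p^k - 1)] is prime to [p] iff [p^k] divides
    [E + 1], which for [E <= N] holds for all [p] simultaneously only if [E = N].
    Raising to the power [totient (p^e)] and gluing by the Chinese remainder
    theorem turns these tests into [c_kl], of rank [H^O(H)]. *)

(** * Divisibility and size of binomial coefficients *)

Section Binomials.
Local Open Scope nat_scope.

(** In [(E + 1) 'C(E, p^k - 1) = p^k 'C(E + 1, p^k)], a factor ['C(E, p^k - 1)] prime to [p] would
    force [p^k] to divide [E + 1]. *)
Lemma prime_dvd_bin_pred p k E : prime p -> ~~ (p ^ k %| E.+1) ->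
  p %| 'C(E, (p ^ k).-1).
Proof.
move=> p_pr; apply: contraR; rewrite -prime_coprime // => co_p.
have pk_gt0 : 0 < p ^ k by rewrite expn_gt0 prime_gt0.
have := mul_bin_diag E.+1 (p ^ k).-1; rewrite prednK //= => eqC.
by rewrite -(Gauss_dvdl _ (coprimeXl k co_p)) eqC dvdn_mulr.
Qed.

(** For [0 < i < p^k], the identity [(N + 1) 'C(N, i - 1) = i 'C(N + 1, i)] forces [p] to divide
    ['C(N + 1, i)]. By Pascal's rule ['C(N, i) = - 'C(N, i - 1)] modulo [p], and the chain starts
    from ['C(N, 0) = 1]. *)
Lemma prime_ndvd_bin_pred p k N : prime p -> p ^ k %| N.+1 ->
  ~~ (p %| 'C(N, (p ^ k).-1)).
Proof.
move=> p_pr dvdN; have pk_gt0 : 0 < p ^ k by rewrite expn_gt0 prime_gt0.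
suff: forall j, j < p ^ k -> ~~ (p %| 'C(N, j)) by apply; rewrite ltn_predL.
elim=> [_|j IHj ltj]; first by rewrite bin0 Euclid_dvd1.
apply: contra (IHj (ltnW ltj)) => dvdC.
have : p %| 'C(N.+1, j.+1).
  rewrite -[j]/(j.+1.-1); apply: (contraR _ (negbT (gtnNdvd (ltn0Sn j) ltj))).
  rewrite -prime_coprime // => co_p.
  rewrite -(Gauss_dvdl _ (coprimeXl k co_p)) /=.
  by rewrite -mul_bin_diag dvdn_mulr.
by rewrite binS dvdn_addr.
Qed.

(** Each step gains a factor [H], because ['C((N + 1) H, N + 1) = H 'C((N + 1) H - 1, N)] and
    [(N + 1) H - 1 >= N H]. *)
Lemma leq_exp_bin H N : 0 < H -> H ^ N <= 'C(N * H, N).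
Proof.
move=> H_gt0; elim: N => [|N IHN]; first by rewrite bin0.
rewrite -(leq_pmul2l (ltn0Sn N)) -mul_bin_diag -mulnA leq_mul2l /=.
rewrite expnS leq_mul2l; apply/orP; right; apply: leq_trans IHN _.
apply: leq_bin2l; rewrite mulSn -ltnS prednK ?addn_gt0 ?H_gt0 //.
by rewrite -addn1 addnC leq_add2r.
Qed.

Lemma leq_bin_exp M k : 'C(M, k) <= M ^ k.
Proof.
elim: k => [|k IHk]; first by rewrite bin0.
rewrite expnS; apply: leq_trans (leq_pmull _ (ltn0Sn k)) _.
by rewrite mul_bin_left leq_mul // leq_subr.
Qed.

Lemma dvdn_prod_primes (s : seq nat) (k : nat -> nat) x :
    uniq s -> all prime s -> {in s, forall p, p ^ k p %| x} ->
  \prod_(p <- s) p ^ k p %| x.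
Proof.
elim: s => [|p s IHs] /=; first by rewrite big_nil dvd1n.
case/andP=> p_s s_uniq /andP[p_pr s_pr] dvdx.
rewrite big_cons Gauss_dvd; last first.
  rewrite big_seq; apply: (big_ind (coprime _)) => [|a b co_a co_b|q q_s].
  - exact: coprimen1.
  - by rewrite coprimeMr co_a.
  rewrite coprimeXl // coprimeXr // prime_coprime // dvdn_prime2 ?(allP s_pr q q_s) //.
  by apply: contra p_s => /eqP->.
rewrite (dvdx p (mem_head p s)) IHs // => q q_s; apply: dvdx.
by rewrite inE q_s orbT.
Qed.

End Binomials.

(** * Gluing the tests modulo the prime powers dividing [m] *)

Section Selector.
Local Open Scope nat_scope.
Variable m : nat.
Hypothesis m_gt0 : 0 < m.

Local Notation pp p := (p ^ logn p m).

Lemma all_prime_primes : all prime (primes m).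
Proof. by apply/allP=> p; rewrite mem_primes => /andP[]. Qed.

(* A polynomial in [E] whose value modulo the [p]-part of [m] is the indicator
   function of [p ^ k p %| E.+1]. *)
Definition selector (k : nat -> nat) (E : nat) : nat :=
  \sum_(p <- primes m)
    (m %/ pp p * 'C(E, (p ^ k p).-1)) ^ totient (pp p).

Lemma selector_mod k E p : p \in primes m ->
  selector k E = (p ^ k p %| E.+1) %[mod pp p].
Proof.
move=> p_m; have:= p_m; rewrite mem_primes m_gt0 => /andP[p_pr /= p_dvd].
have pp_gt0 q : q \in primes m -> 0 < pp q.
  by rewrite mem_primes expn_gt0 => /andP[/prime_gt0->].
have pp_dvd q : pp q %| m := pfactor_dvdnn q m.
rewrite /selector (bigD1_seq p) ?primes_uniq //= -modnDmr.
(* For [q != p] the cofactor [m %/ pp q] is a multiple of [pp p]. *)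
have -> : (\sum_(q <- primes m | q != p)
    (m %/ pp q * 'C(E, (q ^ k q).-1)) ^ totient (pp q)) %% pp p = 0.
  apply/eqP; rewrite -/(_ %| _) big_seq_cond.
  apply: dvdn_sum => q /andP[q_m q_p]; have q_gt0 := pp_gt0 q q_m.
  apply: dvdn_trans (dvdn_exp _ (dvdnn _)); last by rewrite totient_gt0.
  apply: dvdn_mulr; rewrite -(@Gauss_dvdl _ _ (pp q)) ?divnK //.
  rewrite coprimeXl // coprimeXr // prime_coprime //.
  have:= q_m; rewrite mem_primes => /andP[q_pr _].
  by rewrite dvdn_prime2 // eq_sym.
(* Let [e = logn p m]. In the first case the base is prime to [p] and Euler's theorem gives 1. In
   the second [p] divides the base, and [totient (p ^ e) = (p - 1) p ^ (e - 1) >= e] makes the power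
   vanish modulo [p ^ e]. *)
rewrite addn0; case: (boolP (p ^ k p %| E.+1)) => [dvdE|ndvdE].
  apply: Euler_exp_totient; rewrite coprimeXr // coprime_sym prime_coprime //.
  rewrite Euclid_dvdM // negb_or prime_ndvd_bin_pred // andbT.
  have := pfactor_coprime p_pr m_gt0 => -[m' co_m' {1}->].
  by rewrite mulnK ?pp_gt0 // -prime_coprime.
apply/eqP; rewrite mod0n -/(_ %| _) expnMn dvdn_mull //.
apply: dvdn_trans (dvdn_exp2r _ (prime_dvd_bin_pred p_pr ndvdE)).
apply: dvdn_exp2l.
have log_gt0 : 0 < logn p m by rewrite logn_gt0.
rewrite totient_pfactor //; apply: leq_trans (leq_pmull _ _).
  by rewrite -{1}(prednK log_gt0) ltn_expl ?prime_gt1.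
by rewrite -subn1 subn_gt0 prime_gt1.
Qed.

Lemma eqn_mod_primary a b :
  {in primes m, forall p, a = b %[mod pp p]} -> a = b %[mod m].
Proof.
wlog le_ba : a b / b <= a => [IH eq_ab|eq_ab].
  by case/orP: (leq_total b a) => /IH-> // p p_m; rewrite eq_ab.
apply/eqP; rewrite eqn_mod_dvd //; apply/(dvdn_partP _ m_gt0) => p p_m.
by rewrite p_part -eqn_mod_dvd // eq_ab.
Qed.

Lemma selector_full k N : \prod_(p <- primes m) p ^ k p %| N.+1 ->
  selector k N = 1 %[mod m].
Proof.
move=> dvdN; apply: eqn_mod_primary => p p_m; rewrite (selector_mod k N p_m).
by rewrite (dvdn_trans _ dvdN) // (big_rem p) //= dvdn_mulr.
Qed.

Lemma selector_partial k N E : N.+1 = \prod_(p <- primes m) p ^ k p ->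
  E < N -> exists2 p, p \in primes m & selector k E = 0 %[mod pp p].
Proof.
move=> defN ltEN.
have /allPn[p p_m ndvd] : ~~ all (fun p => p ^ k p %| E.+1) (primes m).
  apply/negP => /allP dvdE.
  have := dvdn_prod_primes (primes_uniq m) all_prime_primes dvdE.
  by rewrite -defN => /dvdn_leq -/(_ isT); rewrite ltnS leqNgt ltEN.
by exists p => //; rewrite (selector_mod k E p_m) (negPf ndvd).
Qed.

End Selector.

(** * Factorization rank over a commutative ring *)

Section Rank.
Variables (R : comNzRingType) (I : Type).
Implicit Types (c : I -> I -> R) (L : nat).

(** The inner index ranges over any finite type, so that sums and products of factorizations are
    indexed by sum and product types. *)
Definition rank_le L c :=
  exists T : finType, exists u v : I -> T -> R,
    (#|T| <= L)%N /\ forall k l, c k l = \sum_t u k t * v l t.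

Lemma rank_leW L1 L2 c : (L1 <= L2)%N -> rank_le L1 c -> rank_le L2 c.
Proof.
move=> leL [T [u [v [leT defc]]]]; exists T, u, v.
by split; first exact: leq_trans leL.
Qed.

Lemma eq_rank_le L c c' : (forall k l, c k l = c' k l) ->
  rank_le L c -> rank_le L c'.
Proof.
by move=> eqc [T [u [v [leT defc]]]]; exists T, u, v; split=> // k l; rewrite -eqc.
Qed.

Lemma rank_le0 : rank_le 0 (fun _ _ => 0).
Proof.
exists void, (fun _ _ => 0), (fun _ _ => 0); split=> [|k l]; first by rewrite card_void.
by rewrite big1 // => -[].
Qed.

Lemma rank_le1 : rank_le 1 (fun _ _ => 1).
Proof.
exists unit, (fun _ _ => 1), (fun _ _ => 1); split=> [|k l]; first by rewrite card_unit.
by rewrite big_const card_unit /= addr0 mul1r.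
Qed.

Lemma rank_leZ L a c : rank_le L c -> rank_le L (fun k l => a * c k l).
Proof.
move=> [T [u [v [leT defc]]]]; exists T, (fun k t => a * u k t), v; split=> // k l.
by rewrite defc big_distrr; apply: eq_bigr => t _; rewrite /= mulrA.
Qed.

Lemma rank_leD L1 L2 c1 c2 : rank_le L1 c1 -> rank_le L2 c2 ->
  rank_le (L1 + L2) (fun k l => c1 k l + c2 k l).
Proof.
move=> [T1 [u1 [v1 [leT1 defc1]]]] [T2 [u2 [v2 [leT2 defc2]]]].
exists (T1 + T2)%type, (fun k t => match t with inl t => u1 k t | inr t => u2 k t end),
  (fun k t => match t with inl t => v1 k t | inr t => v2 k t end).
by split=> [|k l]; rewrite ?card_sum ?leq_add // big_sumType defc1 defc2.
Qed.

Lemma rank_leM L1 L2 c1 c2 : rank_le L1 c1 -> rank_le L2 c2 ->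
  rank_le (L1 * L2) (fun k l => c1 k l * c2 k l).
Proof.
move=> [T1 [u1 [v1 [leT1 defc1]]]] [T2 [u2 [v2 [leT2 defc2]]]].
exists (T1 * T2)%type, (fun k t => u1 k t.1 * u2 k t.2),
  (fun k t => v1 k t.1 * v2 k t.2).
split=> [|k l]; first by rewrite card_prod leq_mul.
rewrite defc1 defc2 big_distrlr pair_big /=.
by apply: eq_bigr => t _; rewrite mulrACA.
Qed.

Lemma rank_leX L c e : rank_le L c -> rank_le (L ^ e) (fun k l => c k l ^+ e).
Proof.
move=> rkc; elim: e => [|e IHe]; first exact: rank_le1.
by rewrite expnS; apply: eq_rank_le (rank_leM rkc IHe) => k l; rewrite exprS.
Qed.

Lemma rank_le_sum L (J : eqType) (s : seq J) (F : J -> I -> I -> R) :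
    {in s, forall j, rank_le L (F j)} ->
  rank_le (size s * L) (fun k l => \sum_(j <- s) F j k l).
Proof.
elim: s => [|j s IHs] rkF /=.
  by apply: eq_rank_le rank_le0 => k l; rewrite big_nil.
have rks : rank_le (size s * L) (fun k l => \sum_(i <- s) F i k l).
  by apply: IHs => i i_s; apply: rkF; rewrite inE i_s orbT.
rewrite mulSn; apply: eq_rank_le (rank_leD (rkF j (mem_head j s)) rks) => k l.
by rewrite big_cons.
Qed.

(* ['C(#|S k :&: S l|, d)] counts the [d]-subsets contained in both sets. *)
Lemma rank_le_bin (G : finType) (S : I -> {set G}) d :
  rank_le 'C(#|G|, d) (fun k l => 'C(#|S k :&: S l|, d)%:R).
Proof.
pose D := [set A : {set G} | #|A| == d].
pose u k (t : 'I_#|D|) : R := (enum_val t \subset S k)%:R.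
exists 'I_#|D|, u, u.
split=> [|k l]; first by rewrite card_ord card_draws.
rewrite -(big_enum_val (fun A : {set G} => (A \subset S k)%:R * (A \subset S l)%:R)) /=.
rewrite -cards_draws -sum1dep_card natr_sum big_mkcond [RHS]big_mkcond /=.
apply: eq_bigr => A _; rewrite inE finset.subsetI -natrM mulnb.
by case: (#|A| == d); rewrite ?andbT ?andbF //; case: ifP.
Qed.

End Rank.


(** * The low-rank matrix [c] *)

Lemma leq_expl a b e : (a <= b)%N -> (a ^ e <= b ^ e)%N.
Proof. by case: e => // e; rewrite leq_exp2r. Qed.

Lemma totient_le n : (totient n <= n)%N.
Proof.
rewrite totient_count_coprime -[n in (_ <= n)%N]subn0 -[leqRHS]muln1.
by rewrite -sum_nat_const_nat; apply: leq_sum => d _; case: coprime.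
Qed.

(** The sets are the first [n] of the [N]-subsets of the ground set; two [N]-subsets that share [N]
    points are equal. *)
Lemma uniform_family n H N : (0 < H)%N -> (n <= H ^ N)%N ->
  exists S : 'I_n -> {set 'I_(N * H)},
    (forall k, #|S k| = N) /\ forall k l, k != l -> (#|S k :&: S l| < N)%N.
Proof.
move=> H_gt0 le_n; pose D := [set A : {set 'I_(N * H)} | #|A| == N].
have le_nD : (n <= #|D|)%N.
  by rewrite card_draws card_ord; apply: leq_trans le_n (leq_exp_bin _ H_gt0).
pose S k := enum_val (widen_ord le_nD k).
have cardS k : #|S k| = N by have:= enum_valP (widen_ord le_nD k); rewrite inE => /eqP.
exists S; split=> // k l; apply: contraR; rewrite -leqNgt => leN.
have eqS u v : (N <= #|S u :&: S v|)%N -> S u :&: S v = S u.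
  by move=> le; apply/eqP; rewrite eqEcard subsetIl cardS.
have : S k = S l by rewrite -(eqS k l) // finset.setIC eqS // finset.setIC.
by move=> /enum_val_inj [/val_inj->].
Qed.

Lemma up_log_bound p H : (1 < p)%N -> (1 < H)%N -> (p ^ up_log p H <= p * H)%N.
Proof.
move=> p_gt1 H_gt1; rewrite -(prednK (n := up_log p H)) ?up_log_gt0 ?p_gt1 //.
by rewrite expnS leq_mul // ltnW // up_log_gtn.
Qed.

(* The ground set has at most [H ^ (2 m + 1)] points, the binomials have lower
   index at most [m H] and are raised to powers at most [m]; the last [+ 1]
   absorbs the number of primes. *)
Definition rank_exponent m := ((2 * m).+1 * m ^ 2).+1.

Lemma prodn_bounds (s : seq nat) (F : nat -> nat) a b :
    {in s, forall p, a <= F p <= b}%N ->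
  (a ^ size s <= \prod_(p <- s) F p <= b ^ size s)%N.
Proof.
elim: s => [|p s IHs] bF; first by rewrite big_nil.
have /andP[aF Fb] := bF p (mem_head p s).
rewrite big_cons !expnS; have /IHs/andP[aP Pb]: {in s, forall p, a <= F p <= b}%N.
  by move=> q q_s; apply: bF; rewrite inE q_s orbT.
by rewrite !leq_mul.
Qed.

Lemma matching_matrix m n H : (1 < m)%N -> (m <= H)%N ->
    (n <= H ^ (H ^ size (primes m)).-1)%N ->
  exists c : 'I_n -> 'I_n -> 'Z_m,
    [/\ forall k, c k k = 1,
        forall k l, k != l -> exists2 p, p \in primes m
          & (c k l = 0 %[mod p ^ logn p m])%N
      & rank_le (H ^ (rank_exponent m * H)) c].
Proof.
move=> m_gt1 le_mH le_n; have m_gt0 := ltnW m_gt1.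
have H_gt1 := leq_trans m_gt1 le_mH; have H_gt0 := ltnW H_gt1.
(* Each [p ^ k p] is the least power of [p] reaching [H], hence at most [p H]. The sets will have
   [Q.-1] elements. *)
pose k p := up_log p H; pose Q := (\prod_(p <- primes m) p ^ k p)%N.
have pr p : p \in primes m -> (1 < p)%N /\ (p <= m)%N.
  rewrite mem_primes m_gt0 => /andP[p_pr /= /dvdn_leq le_pm].
  by rewrite prime_gt1 // le_pm.
have pk_bounds p : p \in primes m -> (H <= p ^ k p <= m * H)%N.
  move=> /pr[p_gt1 p_le]; rewrite up_logP //=.
  by apply: leq_trans (up_log_bound p_gt1 H_gt1) _; rewrite leq_mul.
have size_le : (size (primes m) <= m)%N.
  rewrite -[m in (_ <= m)%N](size_iota 1 m); apply: uniq_leq_size (primes_uniq m) _.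
  by move=> p /pr[p_gt1 p_le]; rewrite mem_iota ltnW // add1n ltnS.
have /andP[Q_ge Q_le] := prodn_bounds pk_bounds; rewrite -/Q in Q_ge Q_le.
have Q_gt0 : (0 < Q)%N by apply: leq_trans Q_ge; rewrite expn_gt0 H_gt0.
have le_nQ : (n <= H ^ Q.-1)%N.
  apply: leq_trans le_n _; rewrite leq_exp2l // -!subn1; exact: leq_sub2r.
have [S [cardS cardSI]] := uniform_family H_gt0 le_nQ.
pose c (i j : 'I_n) : 'Z_m := (selector m k #|S i :&: S j|)%:R.
have valc i j d : (d %| m)%N -> (c i j = selector m k #|S i :&: S j| %[mod d])%N.
  by move=> dm; rewrite /c val_Zp_nat // modn_dvdm.
exists c; split.
- move=> i; apply: val_inj; rewrite /= /c val_Zp_nat // finset.setIid cardS.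
  by rewrite (selector_full m_gt0) ?(prednK Q_gt0) // Zp_cast.
- move=> i j /cardSI ltS.
  have [|p p_m sel0] := selector_partial m_gt0 (k := k) _ ltS; first by rewrite prednK.
  by exists p => //; rewrite valc // pfactor_dvdnn.
pose M := (Q.-1 * H)%N.
(* [Q <= (m H) ^ m <= H ^ (2 m)], using [m <= H]. *)
have M_le : (M <= H ^ (2 * m).+1)%N.
  rewrite expnSr leq_mul2r; apply/orP; right; apply: leq_trans (leq_pred _) _.
  apply: leq_trans Q_le _; rewrite expnM.
  apply: leq_trans (leq_pexp2l _ size_le) _; first by rewrite muln_gt0 m_gt0.
  by rewrite leq_exp2r // expnS expn1 leq_mul.
pose L := (H ^ ((2 * m).+1 * m ^ 2 * H))%N.
apply: (@rank_leW _ _ (size (primes m) * L)).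
  apply: leq_trans (leq_mul (leq_trans size_le le_mH) (leqnn L)) _.
  by rewrite /L /rank_exponent -expnS leq_exp2l // mulSn -add1n leq_add2r.
(* Casting the selector into ['Z_m] exposes it as a sum of powers of scaled binomials, to which the
   rank calculus applies. *)
apply: (@eq_rank_le _ _ _ (fun i j => \sum_(p <- primes m)
    ((m %/ p ^ logn p m)%:R * 'C(#|S i :&: S j|, (p ^ k p).-1)%:R) ^+
      totient (p ^ logn p m))).
  move=> i j; rewrite /c /selector natr_sum; apply: eq_bigr => p _.
  by rewrite natrX natrM.
apply: rank_le_sum => p p_m.
apply: rank_leW (rank_leX _ (rank_leZ _ (rank_le_bin _ S _))).
rewrite card_ord -/M.
have [p_gt1 p_le] := pr p p_m; have /andP[_ pk_le] := pk_bounds p p_m.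
set d := (p ^ k p).-1; set t := totient _.
have t_gt0 : (0 < t)%N.
  by rewrite totient_gt0 expn_gt0 ltnW.
have t_le : (t <= m)%N.
  apply: leq_trans (dvdn_leq m_gt0 (pfactor_dvdnn p m)).
  exact: totient_le.
have d_le : (d <= m * H)%N := leq_trans (leq_pred _) pk_le.
have : ('C(M, d) <= (H ^ (2 * m).+1) ^ (m * H))%N.
  apply: leq_trans (leq_bin_exp M d) _.
  apply: leq_trans (leq_pexp2l _ d_le); last by rewrite expn_gt0 H_gt0.
  exact: leq_expl.
rewrite -(leq_exp2r _ _ t_gt0) => /leq_trans; apply.
rewrite -!expnM leq_exp2l // -!mulnA leq_mul2l /= leq_mul2l.
by rewrite [leqRHS]mulnC leq_mul2l t_le !orbT.
Qed.

(** * Coefficients of [A c B] and the 1-a-strong property *)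

Section Representation.
Variables (m n : nat).
Implicit Types (c : 'I_n -> 'I_n -> 'Z_m).

(** These are the entries of [A c B], expanded so that [A B] is the instance where [c] is the
    identity matrix. *)
Definition weighted_product c : 'M[matpoly m n]_n :=
  \matrix_(i, j) \sum_k \sum_l c k l *: (Avar m i k * Bvar m l j).

Lemma matrix_product_weighted :
  Amat m n *m Bmat m n = weighted_product (fun k l => (k == l)%:R).
Proof.
apply/matrixP=> i j; rewrite !mxE; apply: eq_bigr => k _.
rewrite (bigD1 k) //= big1 ?eqxx ?scale1r ?addr0 ?mxE // => l /negPf nkl.
by rewrite eq_sym nkl scale0r.
Qed.

Definition AB_mon (i j k l : 'I_n) :=
  mnm_add (mnm1 (lshift (n * n) (mxvec_index i k)))
          (mnm1 (rshift (n * n) (mxvec_index l j))).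

Lemma AB_monE i j k l a :
  AB_mon i j k l a = ((lshift (n * n) (mxvec_index i k) == a) +
                      (rshift (n * n) (mxvec_index l j) == a))%N.
Proof. by rewrite mnmDE !mnm1E. Qed.

Lemma mxvec_index_inj (i j k l : 'I_n) :
  mxvec_index i j = mxvec_index k l -> i = k /\ j = l.
Proof. by move=> /cast_ord_inj/enum_rank_inj[-> ->]. Qed.

(** The exponent of the variable [a_ik] determines [k], and that of [b_lj] determines [l]. *)
Lemma AB_mon_inj i j k l k' l' :
  AB_mon i j k l = AB_mon i j k' l' -> k = k' /\ l = l'.
Proof.
move=> /mnmP eqm; split.
  have := eqm (lshift _ (mxvec_index i k)); rewrite !AB_monE !eq_rlshift eqxx.
  by rewrite (inj_eq (@lshift_inj _ _)); case: eqP => // /mxvec_index_inj[_ ->].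
have := eqm (rshift _ (mxvec_index l j)); rewrite !AB_monE !eq_lrshift eqxx.
by rewrite (inj_eq (@rshift_inj _ _)); case: eqP => // /mxvec_index_inj[->].
Qed.

Lemma mcoeff_weighted_product c i j mon :
  mcoeff mon (weighted_product c i j) =
  \sum_k \sum_l c k l * (AB_mon i j k l == mon)%:R.
Proof.
rewrite mxE raddf_sum; apply: eq_bigr => k _; rewrite raddf_sum /=.
by apply: eq_bigr => l _; rewrite mcoeffZ -mpolyXD mcoeffX.
Qed.

(** The alternative is uniform in [c], so the coefficients of [A B] and of [A c B] at a monomial are
    read off at the same pair [k], [l]. *)
Lemma mcoeff_weighted_productP i j mon :
  (forall c, mcoeff mon (weighted_product c i j) = 0) \/
  exists k l, mon = AB_mon i j k l /\
    forall c, mcoeff mon (weighted_product c i j) = c k l.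
Proof.
case: (pickP (fun kl : 'I_n * 'I_n => AB_mon i j kl.1 kl.2 == mon)) => [[k l]|no].
  move=> /= /eqP <-; right; exists k, l; split=> // c.
  rewrite mcoeff_weighted_product (bigD1 k) //= (bigD1 l) //= eqxx mulr1.
  rewrite !big1 ?addr0 // => [k' nk|l' nl]; last first.
    by case: (_ =P AB_mon i j k l) nl => [/AB_mon_inj[_ ->]|_ _]; rewrite ?eqxx ?mulr0.
  rewrite big1 // => l' _.
  by case: (_ =P AB_mon i j k l) nk => [/AB_mon_inj[-> _]|_ _]; rewrite ?eqxx ?mulr0.
left=> c; rewrite mcoeff_weighted_product big1 // => k _; rewrite big1 // => l _.
by have /= -> := no (k, l); rewrite mulr0.
Qed.

Lemma multilinear_weighted_product c i j : multilinear (weighted_product c i j).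
Proof.
move=> mon; rewrite mcoeff_msupp.
case: (mcoeff_weighted_productP i j mon) => [->|[k [l [-> _]]] _ a].
  by rewrite eqxx.
by rewrite AB_monE; case: eqP => [<-|_]; rewrite ?eq_rlshift ?leq_b1.
Qed.

(** On the diagonal both coefficients are 1. Off it the coefficient of [A B] is already 0, so only
    the congruence modulo one prime power is at stake. *)
Lemma weighted_product_strong c : (1 < m)%N ->
    (forall k, c k k = 1) ->
    (forall k l, k != l -> exists2 p, p \in primes m
          & (c k l = 0 %[mod p ^ logn p m])%N) ->
  strong_1a_product (weighted_product c).
Proof.
move=> m_gt1 c1 c0 i j; rewrite matrix_product_weighted.
split; [split; try exact: multilinear_weighted_product|] => I; rewrite /set_coef.
  case: (mcoeff_weighted_productP i j (mesym1 I)) => [E0|[k [l [_ Ec]]]].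
    (* The two coefficients are equal, so any prime divisor of [m] is a witness. *)
    exists (pdiv m); last by rewrite !E0.
    by rewrite mem_primes pdiv_prime // ltnW //= pdiv_dvd.
  rewrite !Ec; have [<-|/[dup] nkl /c0[p p_m ckl]] := eqVneq k l; last by exists p.
  exists (pdiv m); last by rewrite c1.
  by rewrite mem_primes pdiv_prime // ltnW //= pdiv_dvd.
move=> p p_m; case: (mcoeff_weighted_productP i j (mesym1 I)) => [E0|[k [l [_ Ec]]]].
  by rewrite !E0.
by rewrite !Ec; have [<-|//] := eqVneq k l; rewrite c1.
Qed.

End Representation.

(** * The bilinear circuit of a factorization *)

Section Circuit.
Variables (R : comNzRingType) (n : nat) (T : finType) (u v : 'I_n -> T -> R).

(** With [c = U V], the linear gates are the entries [(i, t)] of [A U] and [(t, j)] of [V B];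
    product gate [(i, j, t)] multiplies them. The Kronecker deltas restrict a form to one row of [A]
    or one column of [B], and an output to its own products. *)
Definition factored_circuit :
    bilinear_circuit R ('I_n * 'I_n)%type ('I_n * 'I_n)%type ('I_n * 'I_n)%type :=
  @BilinearCircuit R _ _ _ #|{: 'I_n * T}| #|{: 'I_n * T}| #|{: 'I_n * 'I_n * T}|
    (fun s w => (w.1 == (enum_val s).1)%:R * u w.2 (enum_val s).2)
    (fun s w => (w.2 == (enum_val s).1)%:R * v w.1 (enum_val s).2)
    (fun q => enum_rank ((enum_val q).1.1, (enum_val q).2))
    (fun q => enum_rank ((enum_val q).1.2, (enum_val q).2))
    (fun z q => (z == (enum_val q).1)%:R).

Lemma factored_circuit_output (P : algType R) (x y : 'I_n * 'I_n -> P) i j :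
  circuit_output factored_circuit x y (i, j) =
  \sum_k \sum_l (\sum_t u k t * v l t) *: (x (i, k) * y (l, j)).
Proof.
rewrite /circuit_output /=.
(* The contribution of product gate [q] to output [(i, j)], with the deltas inside the linear forms
   resolved. *)
pose F (q : 'I_n * 'I_n * T) : P := ((i, j) == q.1)%:R *:
  ((\sum_k u k q.2 *: x (q.1.1, k)) * (\sum_l v l q.2 *: y (l, q.1.2))).
transitivity (\sum_(q < #|{: 'I_n * 'I_n * T}|) F (enum_val q)).
  apply: eq_bigr => q _; rewrite /F; case: (enum_val q) => -[a b] t /=.
  congr (_ *: (_ * _)).
    pose G a' k := ((a' == a)%:R * u k t) *: x (a', k).
    rewrite (eq_bigr (fun w => G w.1 w.2)); last by move=> [a' k] _; rewrite enum_rankK.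
    rewrite -(pair_bigA _ G) (bigD1 a) //= [X in _ + X]big1 ?addr0.
      by apply: eq_bigr => k _; rewrite /G eqxx mul1r.
    move=> a' /negPf na; rewrite big1 // => k _.
    by rewrite /G na mul0r scale0r.
  pose G l b' := ((b' == b)%:R * v l t) *: y (l, b').
  rewrite (eq_bigr (fun w => G w.1 w.2)); last by move=> [l b'] _; rewrite enum_rankK.
  rewrite -(pair_bigA _ G); apply: eq_bigr => l _.
  rewrite (bigD1 b) //= big1 ?addr0 /G ?eqxx ?mul1r // => b' /negPf nb.
  by rewrite nb mul0r scale0r.
rewrite -(big_enum_val (A := predT) F) /=.
rewrite (eq_bigr (fun q => F (q.1, q.2))); last by case.
rewrite -(pair_bigA _ (fun a t => F (a, t))) /= (bigD1 (i, j)) //=.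
rewrite [X in _ + X]big1 ?addr0; last first.
  by move=> a na; rewrite big1 // => t _; rewrite /F /= eq_sym (negPf na) scale0r.
rewrite (eq_bigr (fun t => \sum_k \sum_l (u k t * v l t) *: (x (i, k) * y (l, j)))).
  rewrite exchange_big; apply: eq_bigr => k _ /=; rewrite exchange_big.
  by apply: eq_bigr => l _; rewrite scaler_suml.
move=> t _; rewrite /F /= eqxx scale1r big_distrlr; apply: eq_bigr => k _.
by apply: eq_bigr => l _; rewrite /= -scalerAl -scalerAr scalerA.
Qed.

Lemma factored_circuit_size :
  circuit_size factored_circuit = (2 * (n * #|T|) + n ^ 2 * #|T| + n ^ 2)%N.
Proof. by rewrite /circuit_size /= !card_prod !card_ord addnn -mul2n mulnn. Qed.

End Circuit.

(** * From circuits to straight-line computations *)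

Section Computation.
Variables (R : nzRingType) (N : nat).
Implicit Types (s : seq (mpoly N R)) (k d : nat).

Definition extends_to s k (P : seq (mpoly N R) -> Prop) :=
  exists s', [/\ computation s' k, {subset s <= s'} & P s'].

Lemma computation_sum s k (I : Type) (r : seq I) (a : I -> R) F (i0 : 'I_N) :
    computation s k -> (forall i, F i \in s) ->
  extends_to s k (fun s' => \sum_(i <- r) a i *: F i \in s').
Proof.
move=> cs Fs; elim: r => [|i r [s1 [cs1 ss1 sums1]]].
  (* The empty sum has to be computed too, as 0 times a variable. *)
  exists [:: 0 *: mpolyX R (mnm1 i0), mpolyX R (mnm1 i0) & s]; split.
  - by apply: comp_scale; [apply: comp_var | rewrite mem_head].
  - by move=> f fs; rewrite !inE fs !orbT.
  - by rewrite big_nil scale0r mem_head.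
exists [:: a i *: F i + \sum_(i <- r) a i *: F i, a i *: F i & s1]; split.
- apply: comp_add; [|by rewrite mem_head|by rewrite inE sums1 orbT].
  by apply: comp_scale => //; apply: ss1.
- by move=> f /ss1 fs; rewrite !inE fs !orbT.
- by rewrite big_cons mem_head.
Qed.

(** The cost [d] per member is assumed over every extension of [s], because the members are computed
    one after another. *)
Lemma computation_family s k d (I : finType) (F : I -> mpoly N R) :
    (forall i s' k', computation s' k' -> {subset s <= s'} ->
      extends_to s' (k' + d) (fun s'' => F i \in s'')) ->
    computation s k ->
  extends_to s (k + #|I| * d) (fun s' => forall i, F i \in s').
Proof.
move=> stepF cs.
suff [s' [cs' ss' Fs']] : extends_to s (k + size (enum I) * d)
    (fun s' => {in enum I, forall i, F i \in s'}).
  exists s'; split=> [||i]; [by rewrite cardE | by [] |].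
  by apply: Fs'; rewrite mem_enum.
elim: (enum I) => [|i r [s1 [cs1 ss1 Fs1]]]; first by exists s; rewrite /= addn0; split.
have [s2 [cs2 ss2 Fs2]] := stepF i s1 _ cs1 ss1.
exists s2; split=> [||j].
- by rewrite /= mulSn addnCA addnC.
- by move=> f /ss1/ss2.
- by rewrite inE => /predU1P[->//|/Fs1/ss2].
Qed.

Lemma circuit_computation (X Y Z : finType) (D : bilinear_circuit R X Y Z)
    (x : X -> 'I_N) (y : Y -> 'I_N) : (0 < N)%N ->
  exists2 s, computation s (prods D)
    & forall z, circuit_output D (fun w => mpolyX R (mnm1 (x w)))
                                 (fun w => mpolyX R (mnm1 (y w))) z \in s.
Proof.
move=> N_gt0; pose i0 := Ordinal N_gt0.
pose xv w := mpolyX R (mnm1 (x w)); pose yv w := mpolyX R (mnm1 (y w)).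
(* Variables and linear combinations are families of cost [d = 0]; only the product gates have cost
   1. *)
have vars (W : finType) (w : W -> 'I_N) s k : computation s k ->
    extends_to s k (fun s' => forall i, mpolyX R (mnm1 (w i)) \in s').
  rewrite -[k in extends_to _ k]addn0 -(muln0 #|W|).
  apply: computation_family => i s' k' cs' _; exists (mpolyX R (mnm1 (w i)) :: s').
  split=> [|f fs|]; rewrite ?addn0 ?inE ?eqxx ?fs ?orbT //.
  exact: comp_var.
have sums (I W : finType) (a : I -> W -> R) (F : W -> mpoly N R) s k :
    computation s k -> (forall w, F w \in s) ->
    extends_to s k (fun s' => forall i, \sum_w a i w *: F w \in s').
  move=> cs Fs; rewrite -[k in extends_to _ k]addn0 -(muln0 #|I|).
  apply: computation_family => // i s' k' cs' ss'; rewrite addn0.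
  by apply: computation_sum => // w; apply: ss'.
have [s1 [cs1 _ xs1]] := vars _ x _ _ (comp_nil R N).
have [s2 [cs2 ss2 ys2]] := vars _ y _ _ cs1.
have [s3 [cs3 ss3 Xs3]] :=
  sums _ _ (@xcoef _ _ _ _ D) xv _ _ cs2 (fun w => ss2 _ (xs1 w)).
have [s4 [cs4 ss4 Ys4]] :=
  sums _ _ (@ycoef _ _ _ _ D) yv _ _ cs3 (fun w => ss3 _ (ys2 w)).
pose P (t : 'I_(prods D)) := (\sum_i xcoef D (xarg D t) i *: xv i) *
     (\sum_j ycoef D (yarg D t) j *: yv j).
have [s5 [cs5 ss5 Ps5]] : extends_to s4 (0 + #|'I_(prods D)| * 1)
    (fun s => forall t, P t \in s).
  apply: computation_family cs4 => t s k cs ss; exists (P t :: s).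
  rewrite addn1 mem_head; split=> // [|f fs]; last by rewrite inE fs orbT.
  by apply: comp_mul => //; apply: ss; [apply: ss4|].
rewrite add0n muln1 card_ord in cs5.
have [s6 [cs6 _ Zs6]] := sums _ _ (@outcoef _ _ _ _ D) P _ _ cs5 Ps5.
by exists s6.
Qed.

End Computation.

(** * Cost of computing [A c B] *)

Section MatrixCircuits.
Variables (m n : nat).

Lemma matrix_product_circuit L (c : 'I_n -> 'I_n -> 'Z_m) : rank_le L c ->
  exists D : matrix_circuit m n,
    [/\ circuit_computes D (weighted_product c),
        computable_with (weighted_product c) (prods D)
      & (circuit_size D <= n ^ 2 * (4 * L.+1))%N].
Proof.
move=> [T [u [v [leT defc]]]]; exists (factored_circuit u v).
have compD : circuit_computes (factored_circuit u v) (weighted_product c).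
  move=> i j; rewrite factored_circuit_output mxE.
  by apply: eq_bigr => k _; apply: eq_bigr => l _; rewrite defc.
split=> //.
  (* For [n = 0] there are no variables and no entries, and the empty computation suffices. *)
  have [n0|n_gt0] := posnP n.
    exists [::]; last by move=> i; have := ltn_ord i; rewrite {2}n0.
    by rewrite /= !card_prod !card_ord [in computation _ _]n0; exact: comp_nil.
  have N_gt0 : (0 < n * n + n * n)%N by rewrite addn_gt0 muln_gt0 n_gt0.
  have [s cs Ds] := circuit_computation (factored_circuit u v)
    (fun w => lshift (n * n) (mxvec_index w.1 w.2))
    (fun w => rshift (n * n) (mxvec_index w.1 w.2)) N_gt0.
  by exists s => // i j; rewrite compD.
rewrite factored_circuit_size.
have le_n : (n <= n ^ 2)%N by case: (n) => // k; rewrite -mulnn leq_pmull.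
apply: (@leq_trans (2 * (n ^ 2 * L.+1) + n ^ 2 * L.+1 + n ^ 2 * L.+1)).
  have leT' := leqW leT.
  by rewrite !leq_add ?leq_pmulr //; do ?apply: leq_mul.
by rewrite (mulnCA _ 4) -addnA addnn -mul2n -mulnDl.
Qed.

End MatrixCircuits.

(** * Growth estimates *)

Local Open Scope classical_set_scope.

Section Asymptotics.
Variable R : realType.

Lemma near_ln_ge (A : R) : \forall n \near \oo, A <= ln (n%:R : R).
Proof.
near=> n.
have expA : expR A <= n%:R by near: n; exact: nbhs_infty_ger.
rewrite -[A in A <= _]expRK ler_ln ?posrE ?expR_gt0 //.
exact: lt_le_trans (expR_gt0 A) expA.
Unshelve. all: by end_near. Qed.

(** With [x = ln n], [ln (c x / 2) < c x / 2] gives [ln x < c x / 2 - ln (c / 2)], and the last term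
    is absorbed by [c x / 2] for large [x]. *)
Lemma near_lnln_le (c : R) : 0 < c ->
  \forall n \near \oo, ln (ln (n%:R : R)) <= c * ln n%:R.
Proof.
move=> c_gt0; near=> n; set x : R := ln n%:R.
have c2_gt0 : 0 < c / 2 by rewrite divr_gt0.
have x_ge1 : 1 <= x by rewrite /x; near: n; exact: near_ln_ge.
have x_gt0 : 0 < x := lt_le_trans ltr01 x_ge1.
have x_geA : - ln (c / 2) / (c / 2) <= x by rewrite /x; near: n; exact: near_ln_ge.
have : ln (c / 2 * x) < c / 2 * x by apply: ln_sublinear; rewrite mulr_gt0.
rewrite ler_pdivrMr // in x_geA; rewrite lnM ?posrE //.
move: (ln (c / 2)) (ln x) x_geA => u v; lra.
Unshelve. all: by end_near. Qed.

Lemma root_growth_ge0 r n : 0 <= root_growth R r n.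
Proof. exact: powR_ge0. Qed.

Lemma ler_root_growth r n (a : R) : (0 < r)%N -> 0 <= a ->
  a ^+ r <= ln (n%:R : R) * ln (ln n%:R) ^+ r.-1 -> a <= root_growth R r n.
Proof.
move=> r_gt0 a_ge0 le_a; have r_neq0 : r%:R != 0 :> R by rewrite pnatr_eq0 -lt0n.
rewrite -[a in a <= _](powRr1 a_ge0) -(mulfV r_neq0) powRrM powR_mulrn //.
apply: (@ge0_ler_powR R) => //; rewrite ?invr_ge0 ?ler0n // nnegrE ?exprn_ge0 //.
by apply: le_trans le_a; rewrite exprn_ge0.
Qed.

Lemma root_growth_ler r n (a : R) : (0 < r)%N -> 0 <= a ->
  0 <= ln (n%:R : R) * ln (ln n%:R) ^+ r.-1 <= a ^+ r -> root_growth R r n <= a.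
Proof.
move=> r_gt0 a_ge0 /andP[ge0 le_a].
have r_neq0 : r%:R != 0 :> R by rewrite pnatr_eq0 -lt0n.
rewrite -[a in _ <= a](powRr1 a_ge0) -(mulfV r_neq0) powRrM powR_mulrn //.
by apply: (@ge0_ler_powR R) => //; rewrite ?invr_ge0 ?ler0n // nnegrE ?exprn_ge0.
Qed.

(** If [ln (ln n) <= d^2 ln n] with [d <= 1], the radicand is at most
    [d^(2 (r - 1)) (ln n)^r <= (d ln n)^r], since [2 (r - 1) >= r]. *)
Lemma root_growth_littleo r (eps : R) : (2 <= r)%N -> 0 < eps ->
  \forall n \near \oo, root_growth R r n <= eps * ln n%:R.
Proof.
move=> r_ge2 eps_gt0; pose d := Num.min eps 1.
have d_gt0 : 0 < d by rewrite lt_min eps_gt0 ltr01.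
have d_le1 : d <= 1 by rewrite ge_min lexx orbT.
near=> n.
have x_ge1 : 1 <= ln (n%:R : R) by near: n; exact: near_ln_ge.
have y_le : ln (ln (n%:R : R)) <= d ^+ 2 * ln n%:R.
  by near: n; apply: near_lnln_le; rewrite exprn_gt0.
have x_ge0 : 0 <= ln (n%:R : R) := le_trans ler01 x_ge1.
have y_ge0 : 0 <= ln (ln (n%:R : R)) := ln_ge0 x_ge1.
apply: (@le_trans _ _ (d * ln n%:R)); last by rewrite ler_wpM2r // ge_min lexx.
apply: root_growth_ler; [exact: ltnW | by rewrite mulr_ge0 // ltW|].
rewrite mulr_ge0 ?exprn_ge0 //=.
have [r' r_eq] : exists r', r = r'.+2 by case: (r) r_ge2 => [|[|r']] // _; exists r'.
rewrite r_eq /= exprMn [X in _ <= _ * X]exprS mulrCA ler_wpM2l //.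
apply: (@le_trans _ _ ((d ^+ 2 * ln n%:R) ^+ r'.+1)).
  by rewrite lerXn2r // nnegrE // (le_trans y_ge0).
rewrite exprMn ler_wpM2r ?exprn_ge0 // -exprM.
by rewrite ler_wiXn2l // ?ltW // mul2n -addnn addSn ltnS leq_addl.
Unshelve. all: by end_near. Qed.

(** Rests on [2 ^ h = n ^ (h ln 2 / ln n)]. *)
Lemma sq_exp_bigO_littleo (g : nat -> R) :
    (forall eps, 0 < eps -> \forall n \near \oo, `|g n| <= eps * ln n%:R) ->
  sq_exp_bigO g `<=` @sq_littleo R.
Proof.
move=> g_o b [h /eqO_exP[k k_gt0 hO] b_eq].
have ln2_gt0 : 0 < ln 2 :> R by rewrite ln_gt0 // ltr1n.
exists (fun n => h n * ln 2 / ln n%:R).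
  apply/cvgr0Pnorm_le => eps eps_gt0; near=> n.
  have x_gt0 : 0 < ln (n%:R : R).
    by apply: (@lt_le_trans _ _ 1) => //; near: n; exact: near_ln_ge.
  have h_le : `|h n| <= k * `|g n| by near: n.
  have g_le : `|g n| <= eps / (k * ln 2) * ln n%:R.
    by near: n; apply: g_o; rewrite divr_gt0 // mulr_gt0.
  rewrite normrM normrM normfV (gtr0_norm x_gt0) (gtr0_norm ln2_gt0).
  rewrite ler_pdivrMr // -ler_pdivlMr //; apply: le_trans h_le _.
  rewrite -ler_pdivlMl //; apply: le_trans g_le _.
  by rewrite le_eqVlt; apply/orP; left; apply/eqP; field; rewrite !gt_eqF.
near=> n.
have x_gt0 : 0 < ln (n%:R : R).
  by apply: (@lt_le_trans _ _ 1) => //; near: n; exact: near_ln_ge.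
have n_gt0 : 0 < (n%:R : R) by near: n; exact: nbhs_infty_gtr.
have -> : b n = n%:R ^+ 2 * 2 `^ h n by near: n.
rewrite powRD ?(gt_eqF n_gt0) ?implybT // powR_mulrn ?ltW //; congr (_ * _).
by rewrite /powR !gt_eqF // -mulrA mulVf ?mulr1 // gt_eqF.
Unshelve. all: by end_near. Qed.

Lemma sq_exp_bigO_near (g1 g2 : nat -> R) :
    (\forall n \near \oo, g1 n = g2 n) -> sq_exp_bigO g1 `<=` sq_exp_bigO g2.
Proof.
move=> g12 b [h /eqO_exP[k k_gt0 hO] b_eq]; exists h => //.
apply/eqO_exP; exists k => //; near=> n.
have <- : g1 n = g2 n by near: n.
by near: n.
Unshelve. all: by end_near. Qed.

(** Once [ln n >= 1] the radicand is nonnegative, and its power 1/2 is the square root. *)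
Lemma root_growth2 : \forall n \near \oo,
  root_growth R 2 n = Num.sqrt (ln n%:R * ln (ln n%:R)).
Proof.
near=> n.
have x_ge1 : 1 <= ln (n%:R : R) by near: n; exact: near_ln_ge.
rewrite /root_growth expr1 powR12_sqrt // mulr_ge0 ?(le_trans ler01 x_ge1) //.
exact: ln_ge0.
Unshelve. all: by end_near. Qed.

Lemma bounded_in_sq_exp (T K : nat -> nat) (g : nat -> R) (C : R) :
    (forall n, 0 <= g n) -> 0 <= C -> (forall n, 0 < K n)%N ->
    (forall n, T n <= n ^ 2 * K n)%N ->
    (\forall n \near \oo, ln (K n)%:R <= C * g n) ->
  bounded_in T (sq_exp_bigO g).
Proof.
move=> g_ge0 C_ge0 K_gt0 T_le K_le.
have ln2_gt0 : 0 < ln 2 :> R by rewrite ln_gt0 // ltr1n.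
have C'_ge0 : 0 <= C / ln 2 by apply: divr_ge0 => //; exact: ltW.
(* Dividing by [ln 2] turns the bound [expR (C * g n)] on [K n] into a power of 2. *)
exists (fun n => n%:R ^+ 2 * 2 `^ (C / ln 2 * g n)).
  exists (fun n => C / ln 2 * g n); last exact: nearW.
  apply/eqO_exP; exists (C / ln 2 + 1); first exact: ltr_wpDl.
  by apply: nearW => n; rewrite normrM ler_wpM2r // ger0_norm // lerDl.
near=> n; apply: (@le_trans _ _ (n ^ 2 * K n)%:R); first by rewrite ler_nat.
rewrite natrM natrX ler_wpM2l ?exprn_ge0 //.
rewrite /powR gt_eqF // mulrAC divfK ?gt_eqF //.
have Kn_gt0 : (K n)%:R \is @Num.pos R by rewrite posrE ltr0n.
by rewrite -(lnK Kn_gt0) ler_expR; near: n.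
Unshelve. all: by end_near. Qed.


(* If [h ^ (h ^ r - 1) < n] then [ln n >= (h ^ r - 1) ln h] and
   [ln (ln n) >= ln h], so the radicand of [g n] is at least [((h ln h) / 2) ^ r]. *)
Lemma root_growth_gt r n h : (2 <= r)%N -> (8 <= h)%N ->
    (h ^ (h ^ r).-1 < n)%N ->
  h.+1%:R * ln (h.+1%:R : R) <= 8 * root_growth R r n.
Proof.
move=> r_ge2 h_ge8 lt_n; set H : R := h%:R.
have H_ge8 : 8 <= H by rewrite ler_nat.
have H_gt0 : 0 < H by lra.
(* From [ln (1 + x) <= x] at [x = - 1 / 2]. *)
have ln2_ge : 1 / 2 <= ln 2 :> R.
  have := @le_ln1Dx R (- (1 / 2)); have -> : 1 + - (1 / 2) = 2^-1 :> R by lra.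
  by rewrite lnV ?posrE //; lra.
have lnH_ge1 : 1 <= ln H.
  have ln8 : ln (2 ^+ 3) = 3 * ln 2 :> R by rewrite lnXn // mulr_natl.
  apply: (@le_trans _ _ (ln (2 ^+ 3))); first by rewrite ln8; lra.
  by rewrite ler_ln ?posrE ?exprn_gt0 // -natrX; apply: le_trans H_ge8; rewrite ler_nat.
have Hr_ge : 8 * H <= H ^+ r.
  case: r r_ge2 {lt_n} => [|[|r]] // _; rewrite !exprS mulrA.
  have /le_trans -> // : 8 * H <= H * H by rewrite ler_wpM2r // ltW.
  by rewrite ler_peMr ?mulr_ge0 ?exprn_ege1 //; lra.
have x_ge : (H ^+ r - 1) * ln H <= ln n%:R.
  have -> : H ^+ r - 1 = (h ^ r).-1%:R.
    by rewrite -subn1 natrB ?natrX // expn_gt0 (leq_trans _ h_ge8).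
  rewrite mulr_natl -lnXn // -natrX ler_ln; first by rewrite ler_nat ltnW.
    by rewrite posrE ltr0n expn_gt0 (leq_trans _ h_ge8).
  by rewrite posrE ltr0n (leq_ltn_trans _ lt_n).
have x_ge2 : H ^+ r / 2 * ln H <= ln n%:R.
  by apply: le_trans x_ge; rewrite ler_wpM2r ?(le_trans ler01) //; lra.
have y_ge : ln H <= ln (ln n%:R).
  have : H <= ln n%:R.
    apply: le_trans x_ge2; apply: (@le_trans _ _ (H ^+ r / 2)); first by lra.
    by apply: ler_peMr => //; lra.
  by move=> le_H; rewrite ler_ln ?posrE // (lt_le_trans H_gt0).
have a_ge0 : 0 <= H * ln H / 2.
  by rewrite divr_ge0 // mulr_ge0 ?ltW // (lt_le_trans ltr01).
have g_ge : H * ln H / 2 <= root_growth R r n.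
  apply: ler_root_growth => //; first exact: ltnW.
  case: r r_ge2 x_ge2 {lt_n Hr_ge x_ge} => [|r] // _ x_ge2 /=.
  apply: (@le_trans _ _ (H ^+ r.+1 / 2 * ln H * ln H ^+ r)); last first.
    apply: ler_pM => //.
    - rewrite !mulr_ge0 ?exprn_ge0 ?invr_ge0 //; lra.
    - by rewrite exprn_ge0 //; lra.
    - by rewrite lerXn2r // nnegrE; lra.
  have -> : H ^+ r.+1 / 2 * ln H * ln H ^+ r = (H * ln H) ^+ r.+1 / 2.
    by rewrite exprMn [ln H ^+ r.+1]exprS; ring.
  rewrite expr_div_n ler_wpM2l //.
    by rewrite exprn_ge0 // mulr_ge0; lra.
  rewrite lef_pV2 ?posrE ?exprn_gt0 // exprS ler_peMr // exprn_ege1 //; lra.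
have lnS_le : ln (h.+1%:R : R) <= 2 * ln H.
  have -> : 2 * ln H = ln (H ^+ 2) by rewrite lnXn // mulr_natl.
  rewrite ler_ln ?posrE ?exprn_gt0 // -natr1 -/H expr2; nra.
(* Passing from [h] to [h + 1] costs a factor 4, and the halving in [g_ge] a factor 2, whence the
   constant 8. *)
have : h.+1%:R * ln h.+1%:R <= 2 * H * (2 * ln H).
  apply: ler_pM => //; rewrite ?ln_ge0 ?ler1n //.
  by rewrite -natr1 -/H; lra.
lra.
Qed.

End Asymptotics.

(** * Choice of [H] and assembly *)

Section Construction.
Variables (R : realType) (m r : nat).
Hypotheses (m_gt1 : (1 < m)%N) (r_ge2 : (2 <= r)%N) (r_le : (r <= size (primes m))%N).

(** The bound [m + 8] serves both [matching_matrix], which needs [m <= H], and [root_growth_gt],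
    which needs [8 <= h]. *)
Let admissible n h := (m + 8 <= h)%N && (n <= h ^ (h ^ r).-1)%N.

Lemma admissible_ex n : exists h, admissible n h.
Proof.
exists (m + 8 + n)%N; rewrite /admissible leq_addr /=.
have h_gt1 : (1 < m + 8 + n)%N by rewrite -addnA ltn_addr.
have n_le : (n <= m + 8 + n)%N := leq_addl _ _.
move: (m + 8 + n)%N h_gt1 n_le => h h_gt1 n_le.
have hr_gt1 : (1 < h ^ r)%N by rewrite -(exp1n r) ltn_exp2r // ltnW.
apply: (@leq_trans (h ^ 1)); first by rewrite expn1.
by rewrite leq_exp2l // -ltnS prednK // ltnW.
Qed.

Definition threshold n := ex_minn (admissible_ex n).

Definition rank_bound n := (threshold n ^ (rank_exponent m * threshold n))%N.

(** For large [n] the least admissible [H] exceeds [m + 8], so [h = H - 1] can only fail by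
    [h ^ (h ^ r - 1) < n], as [root_growth_gt] requires. *)
Lemma rank_bound_growth : \forall n \near \oo,
  ln (4 * (rank_bound n).+1)%:R <= (8 * (rank_exponent m).+1%:R) * root_growth R r n.
Proof.
near=> n.
have n_big : ((m + 8) ^ ((m + 8) ^ r).-1 < n)%N by near: n; exact: nbhs_infty_gt.
rewrite /rank_bound /threshold; case: ex_minnP => H /andP[H_ge n_le] H_min.
have H_ge8 : (8 <= H)%N := leq_trans (leq_addl _ _) H_ge.
have H_gt : (m + 8 < H)%N.
  by rewrite ltn_neqAle H_ge andbT; apply: contraTneq n_le => <-; rewrite -ltnNge.
have [h H_eq] : exists h, H = h.+1 by case: (H) H_ge8 => // h; exists h.
have h_ge : (m + 8 <= h)%N by rewrite -ltnS -H_eq.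
have h_lt : (h ^ (h ^ r).-1 < n)%N.
  rewrite ltnNge; apply/negP => n_le'; have := H_min h; rewrite /admissible h_ge n_le'.
  by rewrite H_eq ltnn => /(_ isT).
have := @root_growth_gt R r n h r_ge2 (leq_trans (leq_addl _ _) h_ge) h_lt.
rewrite -H_eq => growth.
have H_gt0 : (0 < H)%N by exact: leq_trans H_ge8.
(* [4 (X + 1) <= 8 X <= H ^ H X], as [8 <= H]. *)
have : (4 * (H ^ (rank_exponent m * H)).+1 <= H ^ ((rank_exponent m).+1 * H))%N.
  set X := (H ^ _)%N; have X_gt0 : (0 < X)%N by rewrite expn_gt0 H_gt0.
  apply: (@leq_trans (4 * (2 * X))%N).
    by rewrite leq_mul2l /= mul2n -addnn -addn1 leq_add2l.
  rewrite mulnA mulSn expnD leq_mul // (leq_trans H_ge8) //.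
  by rewrite -{1}(expn1 H) leq_pexp2l.
move: (4 * _)%N => K K_le.
apply: (@le_trans _ _ (ln (H ^ ((rank_exponent m).+1 * H))%:R)).
  (* Once generalized, [K] may be 0, where [ln] takes the value 0. *)
  case: (posnP K) => [->|K_gt0]; last first.
    by rewrite ler_ln ?posrE ?ltr0n ?ler_nat ?expn_gt0 ?H_gt0.
  by rewrite ln0 // ln_ge0 // ler1n expn_gt0 H_gt0.
rewrite natrX lnXn ?ltr0n // -[ln _ *+ _]mulr_natl natrM -mulrA.
by rewrite [8 * _]mulrC -[leRHS]mulrA ler_wpM2l.
Unshelve. all: by end_near. Qed.

Lemma strong_product_construction n :
  exists CD : 'M[matpoly m n]_n * matrix_circuit m n,
    [/\ strong_1a_product CD.1, circuit_computes CD.2 CD.1,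
        computable_with CD.1 (prods CD.2)
      & (circuit_size CD.2 <= n ^ 2 * (4 * (rank_bound n).+1))%N].
Proof.
rewrite /rank_bound /threshold; case: ex_minnP => H /andP[H_ge n_le] _.
have m_le : (m <= H)%N := leq_trans (leq_addr _ _) H_ge.
have H_gt0 : (0 < H)%N := leq_trans (ltnW m_gt1) m_le.
(* The threshold is set by [r]; all primes of [m] are used, which only enlarges the exponent. *)
have n_le' : (n <= H ^ (H ^ size (primes m)).-1)%N.
  apply: leq_trans n_le _; rewrite leq_pexp2l // -!subn1 leq_sub2r //.
  by rewrite leq_pexp2l.
have [c [c1 c0 rkc]] := matching_matrix m_gt1 m_le n_le'.
have [D [compD multD sizeD]] := matrix_product_circuit rkc.
by exists (weighted_product c, D); split=> //; exact: weighted_product_strong.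
Qed.

Lemma strong_products_root_growth :
  exists C : forall n : nat, 'M[matpoly m n]_n,
    [/\ forall n, strong_1a_product (C n),
        exists2 mults : nat -> nat,
          forall n, computable_with (C n) (mults n)
          & bounded_in mults (sq_exp_bigO (root_growth R r))
      & exists2 D : forall n : nat, matrix_circuit m n,
          forall n, circuit_computes (D n) (C n)
          & bounded_in (fun n => circuit_size (D n)) (sq_exp_bigO (root_growth R r))].
Proof.
pose CD n := sval (cid (strong_product_construction n)).
have CDP n := svalP (cid (strong_product_construction n)).
have bounded T : (forall n, T n <= n ^ 2 * (4 * (rank_bound n).+1))%N ->
    bounded_in T (sq_exp_bigO (root_growth R r)).
  move=> T_le; apply: bounded_in_sq_exp T_le rank_bound_growth => // [n|].
    exact: root_growth_ge0.
  by rewrite mulr_ge0.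
exists (fun n => (CD n).1); split=> [n||].
- by have [] := CDP n.
- exists (fun n => prods (CD n).2) => [n|]; first by have [] := CDP n.
  (* The product gates are among the gates counted by the size. *)
  apply: bounded => n; have [_ _ _] := CDP n; apply: leq_trans.
  by rewrite /circuit_size addnAC leq_addl.
- exists (fun n => (CD n).2) => [n|]; first by have [] := CDP n.
  by apply: bounded => n; have [] := CDP n.
Qed.

End Construction.

Theorem theorem8 (R : realType) (m : nat) (hm : (1 < m)%N) :
  ((2 <= size (primes m))%N ->
    let g : nat -> R := fun n => Num.sqrt (ln n%:R * ln (ln n%:R)) in
    sq_exp_bigO g `<=` @sq_littleo R /\
    exists C : forall n : nat, 'M[matpoly m n]_n,
      [/\ forall n, strong_1a_product (C n),
          exists2 mults : nat -> nat,
            forall n, computable_with (C n) (mults n)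
            & bounded_in mults (sq_exp_bigO g)
        & exists2 D : forall n : nat, matrix_circuit m n,
            forall n, circuit_computes (D n) (C n)
            & bounded_in (fun n => circuit_size (D n)) (sq_exp_bigO g)])
  /\
  (forall r : nat, (2 <= r)%N -> (r <= size (primes m))%N ->
    let g : nat -> R := root_growth R r in
    sq_exp_bigO g `<=` @sq_littleo R /\
    exists C : forall n : nat, 'M[matpoly m n]_n,
      [/\ forall n, strong_1a_product (C n),
          exists2 mults : nat -> nat,
            forall n, computable_with (C n) (mults n)
            & bounded_in mults (sq_exp_bigO g)
        & exists2 D : forall n : nat, matrix_circuit m n,
            forall n, circuit_computes (D n) (C n)
            & bounded_in (fun n => circuit_size (D n)) (sq_exp_bigO g)]).
Proof.
have general r : (2 <= r)%N -> (r <= size (primes m))%N ->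
    sq_exp_bigO (root_growth R r) `<=` @sq_littleo R.
  move=> r_ge2 _; apply: sq_exp_bigO_littleo => eps eps_gt0.
  near=> n; rewrite ger0_norm ?root_growth_ge0 //.
  by near: n; exact: root_growth_littleo.
split=> [size_ge2|r r_ge2 r_le] /=; last first.
  by split; [exact: general | exact: strong_products_root_growth].
(* The first claim is the case [r = 2]: the two growth functions agree eventually, so they define
   the same class. *)
have -> : sq_exp_bigO (fun n => Num.sqrt (ln n%:R * ln (ln n%:R))) =
    sq_exp_bigO (root_growth R 2).
  apply/seteqP; split; apply: sq_exp_bigO_near; last exact: root_growth2.
  by near=> n; apply: esym; near: n; exact: root_growth2.
by split; [exact: general | exact: strong_products_root_growth].
Unshelve. all: by end_near. Qed.
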